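(* Let $K\subseteq\mathbb{R}^m$ be a regular cone and let $T=\{x\in\mathbb{R}^n \mid Ax\succeq_K b\}$, where $A\in\mathbb{R}^{m\times n}$ and $b\in\mathbb{R}^m$. Assume $T$ has nonempty interior. Let $\pi^{\top}x\geq\pi_0$ be a valid inequality for $T^I$, where $\pi\in\mathbb{Z}^n$ is non-zero and $\pi_0\in\mathbb{R}$. Assume that $B:=\{x\in T \mid \pi^{\top}x\leq\pi_0\}$ is nonempty and bounded. Then, for some natural number $p\leq 2^n$, there exist vectors $y^1,y^2,\dots,y^p\in K^*$ such that $(y^i)^{\top}A$ is rational for all $i\in\{1,\dots,p\}$ and $\pi^{\top}x\geq\pi_0$ is a valid inequality for the integer hull $Q^I$ of the polyhedron $Q=\{x\in\mathbb{R}^n \mid (y^i)^{\top}Ax\geq (y^i)^{\top}b,\ i\in\{1,\dots,p\}\}$.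
   Context: A cone $K\subseteq\mathbb{R}^m$ is regular if it is pointed, closed, convex and full dimensional. We write $u\succeq_K v$ if $u-v\in K$. The dual cone is $K^*=\{y\in\mathbb{R}^m \mid y^{\top}x\geq 0\ \forall x\in K\}$. For $X\subseteq\mathbb{R}^n$, the integer hull $X^I$ is the convex hull of $X\cap\mathbb{Z}^n$. An inequality is valid for a set if every point of the set satisfies it. *)

(* Defs.v *)
From HB Require Import structures.
From mathcomp Require Import all_boot all_order all_algebra.
From mathcomp Require Import all_classical all_reals all_analysis.

Set Implicit Arguments.
Unset Strict Implicit.
Unset Printing Implicit Defensive.

Import Order.TTheory GRing.Theory Num.Theory.
Import numFieldNormedType.Exports.

Local Open Scope classical_set_scope.
Local Open Scope ring_scope.

Definition dotp (R : realType) (n : nat) (u v : 'cV[R]_n) : R :=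
  (u^T *m v) 0 0.

Definition is_cone (R : realType) (m : nat) (K : set 'cV[R]_m) : Prop :=
  forall (a : R) (x : 'cV[R]_m), 0 <= a -> K x -> K (a *: x).

(* Equality, rather than inclusion, so that a pointed set contains the origin. *)
Definition pointed (R : realType) (m : nat) (K : set 'cV[R]_m) : Prop :=
  K `&` [set x | K (- x)] = [set 0].

Definition affine_set (R : realType) (n : nat) (S : set 'cV[R]_n) : Prop :=
  forall (x y : 'cV[R]_n) (t : R), S x -> S y -> S (t *: x + (1 - t) *: y).

Definition affine_hull (R : realType) (n : nat) (S : set 'cV[R]_n)
    : set 'cV[R]_n :=
  smallest (@affine_set R n) S.

Definition full_dimensional (R : realType) (n : nat) (S : set 'cV[R]_n) : Prop :=
  affine_hull S = setT.

Definition regular_cone (R : realType) (m : nat) (K : set 'cV[R]_m) : Prop :=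
  [/\ is_cone K, pointed K, closed K, convex_set K & full_dimensional K].

Definition cone_ge (R : realType) (m : nat) (K : set 'cV[R]_m)
    (u v : 'cV[R]_m) : Prop :=
  K (u - v).

Definition dual_cone (R : realType) (m : nat) (K : set 'cV[R]_m)
    : set 'cV[R]_m :=
  [set y | forall x, K x -> 0 <= dotp y x].

Definition convex_hull (R : realType) (n : nat) (S : set 'cV[R]_n)
    : set 'cV[R]_n :=
  smallest (@convex_set R 'cV[R]_n) S.

Definition integer_points (R : realType) (n : nat) : set 'cV[R]_n :=
  [set x | forall i, x i 0 \is a Num.int].

Definition integer_hull (R : realType) (n : nat) (X : set 'cV[R]_n)
    : set 'cV[R]_n :=
  convex_hull (X `&` @integer_points R n).

Definition valid_ineq (R : realType) (n : nat) (pi : 'cV[R]_n) (pi0 : R)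
    (S : set 'cV[R]_n) : Prop :=
  forall x, S x -> pi0 <= dotp pi x.

Definition rational_mx (R : realType) (m n : nat) (M : 'M[R]_(m, n)) : Prop :=
  forall i j, rational (M i j).

(* Main.v *)
(* Since [B] is nonempty and bounded, [A] has trivial kernel, so [A^T] is onto
   and, [dual_cone K] having interior points, every point outside [T] is cut off
   by some [y] in [dual_cone K] with [y^T A] integral. Take [N] with
   [|x| < N] on [B]. By compactness finitely many such cuts exclude all points
   with [|x| = N] and [pi^T x <= pi0], and all integer points with [|x| <= N] and
   [pi^T x < pi0]. An integer point beyond the sphere with [pi^T x < pi0] is then
   also excluded, because the segment joining it to a point of [B] meets the
   sphere. Doignon's Helly-type theorem, applied to the integer points with
   [pi^T x < pi0], leaves at most [2 ^ n] of these cuts. *)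

Require Import Defs.
From HB Require Import structures.
From mathcomp Require Import all_boot all_order all_algebra.
From mathcomp Require Import all_classical all_reals all_analysis.
From mathcomp Require Import zify ring lra.

Set Implicit Arguments.
Unset Strict Implicit.
Unset Printing Implicit Defensive.

Import Order.TTheory GRing.Theory Num.Theory.
Import numFieldNormedType.Exports.

Local Open Scope classical_set_scope.
Local Open Scope ring_scope.

(** * Doignon's Helly-type theorem for integer points *)

(** Among more than 2^n integer points two agree modulo 2, so their midpoint is integral. Hence only
    midpoints matter: [S] has to contain the integral ones and each [f i] has to respect them. A
    constraint is [c i <= f i z], and infeasibility means that each point of [S] violates one. *)
Lemma doignon (n : nat) (I : finType) (S : set 'cV[int]_n)
    (f : I -> 'cV[int]_n -> int) (c : I -> int) :
  (forall x y z : 'cV[int]_n, S x -> S y -> x + y = z *+ 2 -> S z) ->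
  (forall i (x y z : 'cV[int]_n), x + y = z *+ 2 -> f i x + f i y = f i z *+ 2) ->
  (forall z, S z -> exists i, f i z < c i) ->
  exists2 J : {set I}, (#|J| <= 2 ^ n)%N &
    forall z, S z -> exists2 i, i \in J & f i z < c i.
Proof.
move=> Smid fmid infeas.
pose P (J : {set I}) := `[< forall z, S z -> exists2 i, i \in J & f i z < c i >].
have PT : P [set: I]%SET.
  by apply/asboolP => z /infeas[i fi]; exists i; rewrite ?finset.in_setT.
(* [J] is minimal among the index sets whose constraints are already infeasible on [S]; it remains
   to refute [2 ^ n < #|J|]. *)
have [J /minsetP[/asboolP PJ Jmin] _] := minset_exists PT.
exists J => //; rewrite leqNgt; apply/negP => Jbig.
(* By minimality, dropping [i] from [J] makes the rest feasible at some [w i]; outside [J] the value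
   0 is a dummy. *)
have /choice[w wP] : forall i, exists w, i \in J ->
    S w /\ forall j, j \in J -> j != i -> c j <= f j w.
  move=> i; case: (boolP (i \in J)) => [iJ|_]; last by exists 0.
  apply: contrapT => H.
  have Pi : P (J :\ i)%SET.
    apply/asboolP => z Sz; apply: contrapT => H2.
    apply: H; exists z => _; split=> // j jJ ji.
    rewrite leNgt; apply/negP => fj; apply: H2; exists j => //.
    by rewrite !inE ji.
  have := Jmin _ Pi (subsetDl _ _) => /setP/(_ i).
  by rewrite !inE eqxx iJ.
(* Relax the thresholds as far as infeasibility allows; each [w i] bounds the
   relaxation of the [i]-th one, so a maximal relaxation exists. *)
pose Q N := `[< exists h : I -> nat, (\sum_(i in J) h i)%N = N /\
  forall z, S z -> exists2 i, i \in J & f i z < c i - (h i)%:Z >].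
have Q0 : exists N, Q N.
  exists 0%N; apply/asboolP; exists (fun=> 0%N); split; first by rewrite big1.
  by move=> z /PJ[i iJ fi]; exists i => //; lia.
(* At [w i] every constraint of [J] other than [i] holds even unrelaxed, so the [i]-th must stay
   violated: [h i < c i - f i (w i)]. *)
have Qbd N : Q N -> (N <= \sum_(i in J) `|(c i - f i (w i))%R|)%N.
  move=> /asboolP[h [<- hS]]; apply: leq_sum => i iJ.
  have [Sw wJ] := wP i iJ.
  have [j jJ fj] := hS _ Sw.
  have [ji|/wJ] := eqVneq j i; last by move=> /(_ jJ); lia.
  by move: fj; rewrite ji; lia.
case: (ex_maxnP Q0 Qbd) => N /asboolP[h [hN hS]] Nmax.
(* Relaxing the [i]-th threshold by one more unit would contradict maximality, so some point becomes
   feasible. Before that unit it violated only constraint [i], and by integrality it missed it by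
   exactly 1. *)
have /choice[x xP] : forall i, exists x, i \in J ->
    [/\ S x, f i x = c i - (h i)%:Z - 1 &
    forall j, j \in J -> j != i -> c j - (h j)%:Z <= f j x].
  move=> i; case: (boolP (i \in J)) => [iJ|_]; last by exists 0.
  apply: contrapT => H.
  suff /Nmax : Q N.+1 by rewrite ltnn.
  apply/asboolP; exists (fun j => h j + (j == i))%N; split.
    rewrite big_split /= hN (bigD1 i) //= eqxx big1 ?addn0 ?addn1 //.
    by move=> j /andP[_ /negbTE ->].
  move=> z Sz; apply: contrapT => H2.
  have key j : j \in J -> c j - (h j)%:Z - (j == i)%:Z <= f j z.
    move=> jJ; rewrite leNgt; apply/negP => fj; apply: H2; exists j => //.
    by lia.
  apply: H; exists z => _.
  have key2 j : j \in J -> j != i -> c j - (h j)%:Z <= f j z.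
    by move=> /key + /negbTE ji; rewrite ji subr0.
  split=> //.
  have [j jJ fj] := hS _ Sz.
  have [ji|/(key2 _ jJ)] := eqVneq j i; last by lia.
  by move: fj (key j jJ); rewrite ji eqxx; lia.
(* There are 2^n parity vectors, so two distinct indices of [J] share one. *)
pose parity i := [ffun k : 'I_n => modz (x i k 0) 2 == 1].
have : ~ {in J &, injective parity}.
  move=> /leq_card_in; rewrite card_ffun card_bool card_ord.
  by move/(leq_trans Jbig); rewrite ltnn.
apply=> i j iJ jJ /ffunP ij; apply/eqP/negPn/negP => nij.
have [Si fi iP] := xP i iJ; have [Sj fj jP] := xP j jJ.
pose z : 'cV[int]_n := \col_k divz (x i k 0 + x j k 0) 2.
have zE : x i + x j = z *+ 2.
  apply/colP => k; rewrite mulr2n !mxE.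
  have := ij k; rewrite !ffunE; move: (x i k 0) (x j k 0) => a d.
  by lia.
(* The midpoint falls short of some relaxed threshold [l] by at least 1, so the values of [f l] at
   [x i] and [x j] fall short by at least 2 in total. Yet at most one of them falls short, and then
   by exactly 1. *)
have [l lJ fl] := hS _ (Smid _ _ _ Si Sj zE).
have := fmid l _ _ _ zE.
have [li|li] := eqVneq l i.
  by subst l; have := jP i iJ nij; lia.
have := iP l lJ li.
have [lj|lj] := eqVneq l j; first by subst l; lia.
by have := jP l lJ lj; lia.
Qed.

(** * The max norm and compactness for column vectors *)

Lemma mx_norm_leP (R : realType) (m n : nat) (M : 'M[R]_(m, n)) (r : R) :
  0 <= r -> `|M| <= r <-> forall i j, `|M i j| <= r.
Proof.
move=> r0; rewrite {1}/Num.norm /= mx_normrE; split.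
  by move=> /bigmax_leP[_ H] i j; exact: (H (i, j)).
by move=> H; apply/bigmax_leP; split=> // -[i j] _; exact: H.
Qed.

Lemma mx_entry_le_norm (R : realType) (m n : nat) (M : 'M[R]_(m, n)) i j :
  `|M i j| <= `|M|.
Proof. by have /(mx_norm_leP M (normr_ge0 M))/(_ i j) := lexx `|M|. Qed.

Lemma norm_trmx (R : realType) (m n : nat) (M : 'M[R]_(m, n)) :
  `|M^T| = `|M|.
Proof.
apply/eqP; rewrite eq_le; apply/andP; split; apply/mx_norm_leP => // i j.
  by rewrite mxE mx_entry_le_norm.
by have := mx_entry_le_norm M^T j i; rewrite mxE.
Qed.

Lemma trmx_continuous (R : realType) (m n : nat) :
  continuous (@trmx R m n).
Proof.
move=> M s /= /(nbhs_ballP M^T) [e e0 es]; apply/nbhs_ballP; exists e => //.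
by move=> N [_ MN]; apply: es; split=> // i j; rewrite !mxE; exact: MN.
Qed.

(** Transposition is continuous and preserves the norm, which carries Heine-Borel over from row
    vectors. *)
Lemma cV_bounded_closed_compact (R : realType) (n : nat) (S : set 'cV[R]_n) :
  bounded_set S -> closed S -> compact S.
Proof.
move=> [M [Mr bS]] cS.
have -> : S = [set x^T | x in [set x : 'rV[R]_n | S x^T]].
  apply/seteqP; split=> [x Sx|_ [x Sx <-] //].
  by exists x^T; rewrite /= trmxK.
apply: continuous_compact.
  by apply: continuous_subspaceT; exact: trmx_continuous.
apply: bounded_closed_compact.
  by exists M; split=> // r /bS H x /H /=; rewrite norm_trmx.
by apply: (@preimage_closed _ _ (@trmx R 1 n) S) => // x _; exact: trmx_continuous.
Qed.

Lemma closed_ball_cV_compact (R : realType) (n : nat) (r : R) :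
  compact [set x : 'cV[R]_n | `|x| <= r].
Proof.
apply: cV_bounded_closed_compact.
  by exists r; split; [exact: num_real|move=> s /ltW rs x /= /le_trans; exact].
apply: (@preimage_closed _ _ (fun x : 'cV[R]_n => `|x|) [set t | t <= r]).
  by move=> x _; exact: norm_continuous.
exact: closed_le.
Qed.

(** * The dot product *)

Section dot_product.
Variables (R : realType) (n : nat).
Implicit Types u v w : 'cV[R]_n.

Lemma dotpE u v : dotp u v = \sum_i u i 0 * v i 0.
Proof. by rewrite /dotp !mxE; apply: eq_bigr => i _; rewrite !mxE. Qed.

Lemma dotpC u v : dotp u v = dotp v u.
Proof. by rewrite !dotpE; apply: eq_bigr => i _; rewrite mulrC. Qed.

Lemma dotpDr u v w : dotp u (v + w) = dotp u v + dotp u w.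
Proof. by rewrite /dotp mulmxDr mxE. Qed.

Lemma dotpZr a u v : dotp u (a *: v) = a * dotp u v.
Proof. by rewrite /dotp -scalemxAr mxE. Qed.

Lemma dotpNr u v : dotp u (- v) = - dotp u v.
Proof. by rewrite -scaleN1r dotpZr mulN1r. Qed.

Lemma dotpBr u v w : dotp u (v - w) = dotp u v - dotp u w.
Proof. by rewrite dotpDr dotpNr. Qed.

Lemma dotp0r u : dotp u 0 = 0.
Proof. by rewrite -(scale0r (0 : 'cV[R]_n)) dotpZr mul0r. Qed.

Lemma dotpDl u v w : dotp (u + v) w = dotp u w + dotp v w.
Proof. by rewrite dotpC dotpDr !(dotpC w). Qed.

Lemma dotpZl a u v : dotp (a *: u) v = a * dotp u v.
Proof. by rewrite dotpC dotpZr dotpC. Qed.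

Lemma dotpNl u v : dotp (- u) v = - dotp u v.
Proof. by rewrite dotpC dotpNr dotpC. Qed.

Lemma dotp0l u : dotp 0 u = 0.
Proof. by rewrite dotpC dotp0r. Qed.

Lemma dotp_sqrDZ u v t :
  dotp (u + t *: v) (u + t *: v)
  = dotp u u + (t * (2 * dotp u v) + t ^+ 2 * dotp v v).
Proof. by rewrite dotpDl !dotpDr !dotpZl !dotpZr (dotpC v u); ring. Qed.

Lemma dotp_ge0 u : 0 <= dotp u u.
Proof. by rewrite dotpE; apply: sumr_ge0 => i _; rewrite -expr2 sqr_ge0. Qed.

Lemma dotp_eq0 u : dotp u u = 0 -> u = 0.
Proof.
rewrite dotpE => /eqP.
rewrite psumr_eq0 => [/allP H|i _]; last by rewrite -expr2 sqr_ge0.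
apply/colP => i; have := H i (mem_index_enum _).
by rewrite mulf_eq0 orbb mxE => /eqP.
Qed.

(** The norm is the maximum of the absolute values of the entries, and the square of each entry is a
    term of the sum. *)
Lemma sqr_norm_le_dotp u : `|u| ^+ 2 <= dotp u u.
Proof.
have d0 := dotp_ge0 u.
rewrite -[leRHS](sqr_sqrtr d0) lerXn2r ?nnegrE ?sqrtr_ge0 ?normr_ge0//.
apply/mx_norm_leP => [|i j]; first exact: sqrtr_ge0.
rewrite -sqrtr_sqr ler_sqrt// ord1 dotpE (bigD1 i) //= -expr2 lerDl.
by apply: sumr_ge0 => k _; rewrite -expr2 sqr_ge0.
Qed.

Lemma dotp_le_norm u : exists2 c : R, 0 <= c & forall v, `|dotp u v| <= c * `|v|.
Proof.
exists (\sum_i `|u i 0|) => [|v]; first by apply: sumr_ge0.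
rewrite dotpE mulr_suml; apply: le_trans (ler_norm_sum _ _ _) _.
apply: ler_sum => i _; rewrite normrM ler_wpM2l//.
exact: mx_entry_le_norm.
Qed.

Lemma dotp_continuous u : continuous (dotp u).
Proof.
rewrite (_ : dotp u = fun v => \sum_i u i 0 * v i 0); last first.
  by apply/funext => v; rewrite dotpE.
apply: (@continuous_big R^o _ _ 0 xpredT (@add_continuous R^o)) => i _ x.
by apply: continuousM; [exact: cst_continuous|exact: coord_continuous].
Qed.

Lemma dotpp_continuous : continuous (fun v => dotp v v).
Proof.
rewrite (_ : (fun v => dotp v v) = fun v => \sum_i v i 0 * v i 0); last first.
  by apply/funext => v; rewrite dotpE.
apply: (@continuous_big R^o _ _ 0 xpredT (@add_continuous R^o)) => i _ x.
by apply: continuousM; exact: coord_continuous.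
Qed.

End dot_product.

Lemma dotp_mulmxr (R : realType) (m n : nat) (y : 'cV[R]_m) (A : 'M[R]_(m, n))
    (x : 'cV[R]_n) :
  dotp y (A *m x) = dotp (A^T *m y) x.
Proof. by rewrite /dotp trmx_mul trmxK mulmxA. Qed.

(** * Finite subcovers, separation from a closed convex cone, interior of its dual *)

Lemma compact_seq_cover (T : ptopologicalType) (I : choiceType) (C : set T)
    (D : set I) (f : I -> set T) :
  compact C -> (forall i, D i -> open (f i)) -> C `<=` cover D f ->
  exists2 s : seq I, (forall i, i \in s -> D i) &
    forall x, C x -> exists2 i, i \in s & f i x.
Proof.
rewrite compact_cover => compC fo /(compC _ _ _ fo)[D' D'D D'C].
exists (finmap.enum_fset D') => [i /D'D /set_mem //|x /D'C[i]].
by exists i.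
Qed.

(** First-order optimality: for small [t] the linear term dominates. It is applied to the squared
    distance along a segment leaving a nearest point. *)
Lemma quadratic_ge0_slope (R : realFieldType) (a b : R) : 0 <= b ->
  (forall t, 0 < t <= 1 -> 0 <= t * (2 * a) + t ^+ 2 * b) -> 0 <= a.
Proof.
move=> b0 H; rewrite leNgt; apply/negP => a0.
have ba : 0 < b - a by lra.
(* With this [t], [t * b <= - a], so [2 * a + t * b <= a < 0]. *)
pose t := - a / (b - a).
have t0 : 0 < t by rewrite divr_gt0// oppr_gt0.
have t1 : t <= 1 by rewrite ler_pdivrMr// mul1r; lra.
have tb : t * b <= - a.
  rewrite /t mulrAC ler_pdivrMr//; nra.
have /H : 0 < t <= 1 by rewrite t0.
rewrite expr2 -mulrA -mulrDr pmulr_rge0//; lra.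
Qed.

Section convex_cone.
Variables (R : realType) (m : nat) (K : set 'cV[R]_m).
Hypotheses (K0 : K 0) (coneK : is_cone K) (convexK : convex_set K)
  (closedK : closed K).

Lemma cone_add x y : K x -> K y -> K (x + y).
Proof.
move=> Kx Ky.
have [h0 h1] : (0 : R) <= 2^-1 /\ (2^-1 : R) <= 1 by split; lra.
have := convexK (Itv01 h0 h1) (mem_set Kx) (mem_set Ky).
move=> /set_mem /(coneK (ler0n _ 2)).
congr K; rewrite /conv /= scalerDr !scalerA /unstable.onem /=.
by rewrite -[RHS]scale1r scalerDr; congr (_ *: _ + _ *: _); field.
Qed.

Lemma nearest_point (v : 'cV[R]_m) : exists2 p, K p &
  forall x, K x -> dotp (p - v) (p - v) <= dotp (x - v) (x - v).
Proof.
(* Since 0 is in [K], points outside the ball of radius [r] cannot win: there the squared distance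
   to [v] is at least [(1 + d) ^+ 2], which exceeds the squared distance [d] from 0. *)
pose d := dotp v v; pose r := `|v| + 1 + d.
have d0 : 0 <= d by exact: dotp_ge0.
have r0 : 0 <= r by rewrite !addr_ge0.
pose C := [set x : 'cV[R]_m | `|x| <= r] `&` K.
have C0 : C 0 by split=> //=; rewrite normr0.
have compC : compact C by apply: compact_closedI => //; exact: closed_ball_cV_compact.
have cont : continuous (fun x : 'cV[R]_m => dotp (x - v) (x - v)).
  move=> x; have := @continuous_comp 'cV[R]_m 'cV[R]_m R
    (fun x : 'cV[R]_m => x - v) (fun w : 'cV[R]_m => dotp w w) x.
  apply; last exact: dotpp_continuous.
  by apply: continuousB; [exact: cvg_id|exact: cst_continuous].
have [|p /set_mem[_ Kp] pmin] := @compact_EVT_min _ _ _ C _ compC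
  (continuous_subspaceT cont); first by exists 0.
exists p => // x Kx.
have [xr|xr] := leP `|x| r; first by apply: pmin; rewrite inE.
have /(le_trans (pmin _ (mem_set C0))) : dotp (0 - v) (0 - v) <= dotp (x - v) (x - v).
  rewrite sub0r dotpNl dotpNr opprK -/d.
  have xv : 1 + d <= `|x - v|.
    by have := ler_normB (x - v) (- v); rewrite opprK subrK normrN /r in xr *; lra.
  apply: le_trans (sqr_norm_le_dotp _).
  by rewrite expr2; nra.
by [].
Qed.

(** The normal is [p - v] for a nearest point [p] of [K]. Moving from [p] along [x] in [K] shows
    [0 <= dotp y x]; moving from [p] towards 0 shows [dotp y p <= 0], whence
    [dotp y v = dotp y p - dotp y y < 0]. *)
Lemma cone_separation v : ~ K v -> exists2 y, dual_cone K y & dotp y v < 0.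
Proof.
move=> nKv; have [p Kp pmin] := nearest_point v.
pose y := p - v.
have expand t x : K (p + t *: x) -> 0 <= t * (2 * dotp y x) + t ^+ 2 * dotp x x.
  by move=> /pmin; rewrite addrAC -/y dotp_sqrDZ lerDl.
have yK : dual_cone K y.
  move=> x Kx; apply: (quadratic_ge0_slope (dotp_ge0 x)) => t /andP[t0 _].
  by apply: expand; apply: cone_add => //; apply: coneK => //; exact: ltW.
exists y => //.
have yp : 0 <= - dotp y p.
  rewrite -dotpNr; apply: (quadratic_ge0_slope (dotp_ge0 (- p))) => t /andP[t0 t1].
  apply: expand; rewrite scalerN -[X in X - _]scale1r -scalerBl.
  by apply: coneK => //; rewrite subr_ge0.
have yy : 0 < dotp y y.
  rewrite lt_neqAle dotp_ge0 andbT; apply/eqP => /esym/dotp_eq0/subr0_eq pv.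
  by apply: nKv; rewrite -pv.
have -> : v = p - y by rewrite opprB addrC subrK.
by rewrite dotpBr; lra.
Qed.

Hypothesis pointedK : pointed K.

(** For a unit vector [x] of [K], pointedness puts [- x] outside [K], so some dual vector is
    positive at [x]. By compactness finitely many of them suffice, and their sum is bounded below by
    some [e] on the unit vectors of [K]; scaling gives the rest of [K]. *)
Lemma dual_cone_interior : exists2 y, dual_cone K y &
  exists2 e : R, 0 < e & forall x, K x -> e * `|x| <= dotp y x.
Proof.
pose C := [set x : 'cV[R]_m | `|x| <= 1] `&` (K `&` [set x | 1 <= `|x|]).
have compC : compact C.
  apply: compact_closedI; first exact: closed_ball_cV_compact.
  apply: closedI => //.
  apply: (@preimage_closed _ _ (fun x : 'cV[R]_m => `|x|) [set t | 1 <= t]).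
    by move=> x _; exact: norm_continuous.
  exact: closed_ge.
have [||D DK Dcov] := @compact_seq_cover _ _ C (dual_cone K)
  (fun y => [set x | 0 < dotp y x]) compC.
- move=> y _; apply: (@open_comp _ _ (dotp y) [set t | 0 < t]).
    by move=> x _; exact: dotp_continuous.
  exact: open_gt.
- move=> x [_ [Kx /= x1]].
  have [|y Dy yx] := @cone_separation (- x).
    move=> KNx; have : [set 0] x by rewrite -pointedK.
    by move=> /= x0; move: x1; rewrite x0 normr0; lra.
  by exists y => //=; move: yx; rewrite dotpNr oppr_lt0.
pose y0 := \sum_(y <- D) y.
have dotp_y0 x : dotp y0 x = \sum_(y <- D) dotp y x.
  rewrite /y0; elim/big_rec2: _ => [|y a b _ <-]; first exact: dotp0l.
  by rewrite dotpDl.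
have Dge0 x y : K x -> y \in D -> 0 <= dotp y x.
  by move=> Kx /DK; apply.
exists y0.
  by move=> x Kx; rewrite dotp_y0 big_seq sumr_ge0// => y; exact: Dge0.
have y0C x : C x -> 0 < dotp y0 x.
  move=> Cx; have [y yD yx] := Dcov _ Cx.
  rewrite dotp_y0 (big_rem y) //=.
  rewrite ltr_wpDr// big_seq sumr_ge0// => z /mem_rem.
  by apply: Dge0; case: Cx => _ [].
have [e e0 eC] : exists2 e : R, 0 < e & forall x, C x -> e <= dotp y0 x.
  have [C0|C0] := pselect (C !=set0); last first.
    by exists 1 => // x Cx; exfalso; apply: C0; exists x.
  have [c /set_mem Cc cmin] := compact_EVT_min C0 compC
    (continuous_subspaceT (@dotp_continuous _ _ y0)).
  by exists (dotp y0 c); [exact: y0C|move=> x /mem_set; exact: cmin].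
exists e => // x Kx.
have [->|x0] := eqVneq x 0; first by rewrite normr0 dotp0r mulr0.
have nx : 0 < `|x| by rewrite normr_gt0.
have /eC : C (`|x|^-1 *: x).
  have n1 : `| `|x|^-1 *: x| = 1.
    by rewrite normrZ normfV normr_id mulVf// gt_eqF.
  split; first by rewrite /= n1.
  split; last by rewrite /= n1.
  by apply: coneK => //; rewrite invr_ge0.
by rewrite dotpZr mulrC ler_pdivlMr.
Qed.

End convex_cone.

(** * Separation with integral [A^T *m y] *)

Lemma dotp_mulmx_le_norm (R : realType) (m n : nat) (C : 'M[R]_(n, m)) :
  exists2 M : R, 0 <= M & forall (r : 'cV[R]_n) x, `|r| <= 1 ->
    `|dotp r (C *m x)| <= M * `|x|.
Proof.
have /choice[c cP] : forall i, exists c : R, 0 <= c /\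
    forall x, `|dotp (row i C)^T x| <= c * `|x|.
  by move=> i; have [c c0 H] := dotp_le_norm (row i C)^T; exists c.
exists (\sum_i c i) => [|r x r1]; first by apply: sumr_ge0 => i _; case: (cP i).
rewrite dotpE mulr_suml; apply: le_trans (ler_norm_sum _ _ _) _.
apply: ler_sum => i _; have [_ /(_ x)] := cP i.
rewrite {1}/dotp trmxK -row_mul mxE normrM => H.
rewrite -[leRHS]mul1r ler_pM//.
exact: le_trans (mx_entry_le_norm _ _ _) r1.
Qed.

(* Perturbing a separating [y] into the interior of [dual_cone K] and scaling
   it up leaves room for a bounded correction [C^T *m r], which rounds [A^T y]
   to an integer vector. *)
Lemma integral_cone_separation (R : realType) (m n : nat) (K : set 'cV[R]_m)
    (A : 'M[R]_(m, n)) (C : 'M[R]_(n, m)) (v : 'cV[R]_m) :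
  K 0 -> is_cone K -> convex_set K -> closed K -> pointed K ->
  C *m A = 1%:M -> ~ K v ->
  exists y, [/\ dual_cone K y, dotp y v < 0 &
    exists g : 'cV[int]_n, A^T *m y = map_mx intr g].
Proof.
move=> K0 coneK convexK closedK pointedK CA nKv.
have [y Dy yv] := cone_separation K0 coneK convexK closedK nKv.
have [z Dz [e e0 ez]] := dual_cone_interior K0 coneK convexK closedK pointedK.
have [M M0 MP] := dotp_mulmx_le_norm C.
(* [s] is small enough that [s * dotp z v] is at most half of [- dotp y v]. *)
have [s s0 sv] : exists2 s : R, 0 < s & dotp (y + s *: z) v < 0.
  exists (- dotp y v / (`|dotp z v| + 1) / 2).
    by rewrite !divr_gt0 ?oppr_gt0 ?ltr_wpDl.
  rewrite dotpDl dotpZl.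
  have h1 : 0 < `|dotp z v| + 1 by rewrite ltr_wpDl.
  have h2 : dotp z v / (`|dotp z v| + 1) <= 1.
    by rewrite ler_pdivrMr// mul1r; have := ler_norm (dotp z v); lra.
  set a := dotp y v in yv *; set c := dotp z v in h1 h2 *.
  have -> : - a / (`|c| + 1) / 2 * c = (- a / 2) * (c / (`|c| + 1)) by ring.
  nra.
pose q := y + s *: z.
have qK x : K x -> s * e * `|x| <= dotp q x.
  move=> Kx; rewrite dotpDl dotpZl; have := Dy _ Kx; have := ez _ Kx.
  by rewrite -mulrA; nra.
have se0 : 0 < s * e by rewrite mulr_gt0.
have qv0 : 0 < - dotp q v by rewrite oppr_gt0.
(* The correction changes values by at most [M * |x|]. The first summand of [D] keeps the sum
   nonnegative on [K], the second keeps it negative at [v], and the final 1 makes the latter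
   strict. *)
pose D := M / (s * e) + M * `|v| / (- dotp q v) + 1.
have t1 : 0 <= M / (s * e) by rewrite divr_ge0// ltW.
have t2 : 0 <= M * `|v| / (- dotp q v) by rewrite divr_ge0 ?mulr_ge0// ltW.
have D0 : 0 <= D by rewrite /D; lra.
have D1 : M <= D * (s * e) by rewrite -ler_pdivrMr// /D; lra.
have D2 : M * `|v| < D * - dotp q v by rewrite -ltr_pdivrMr// /D; lra.
pose w := A^T *m (D *: q).
pose g : 'cV[int]_n := \col_i Num.floor (w i 0).
pose r : 'cV[R]_n := map_mx intr g - w.
have r1 : `|r| <= 1.
  apply/mx_norm_leP => // i j; rewrite ord1 !mxE.
  have /andP[] := floor_itv (w i 0); rewrite intrD !mxE => f1 f2.
  by rewrite ler_norml; apply/andP; split; lra.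
(* As [C *m A = 1], the correction contributes exactly [r] to the image under [A^T], turning [w]
   into its rounding [g]. *)
exists (D *: q + C^T *m r).
have rC x : dotp (C^T *m r) x = dotp r (C *m x) by rewrite dotp_mulmxr.
split.
- move=> x Kx; rewrite dotpDl dotpZl rC.
  have := MP r x r1; rewrite ler_norml => /andP[+ _].
  have := ler_wpM2l D0 (qK _ Kx).
  have := ler_wpM2r (normr_ge0 x) D1.
  by rewrite -!mulrA; lra.
- rewrite dotpDl dotpZl rC.
  have := MP r v r1; rewrite ler_norml => /andP[_].
  by move: D2; rewrite mulrN; lra.
- exists g; rewrite mulmxDr -/w mulmxA -trmx_mul CA trmx1 mul1mx.
  by rewrite addrC subrK.
Qed.

(** * Integer points and validity on integer hulls *)

(** A non-integer lies in the open interval between its floor and the next integer, which is free of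
    integers. *)
Lemma closed_int (R : realType) : closed [set x : R | x \is a Num.int].
Proof.
rewrite -openC openE => x /= nx.
have [f1 f2] := andP (floor_itv x).
have fx : (Num.floor x)%:~R < x.
  rewrite lt_neqAle f1 andbT; apply/negP => /eqP fx.
  by apply: nx; rewrite -fx intr_int.
have xI : x \in `](Num.floor x)%:~R, (Num.floor x + 1)%:~R[ by rewrite in_itv /= fx.
apply: filterS (near_in_itvoo xI) => t; rewrite in_itv /= => /andP[t1 t2].
move=> /intrP[k tk]; move: t1 t2; rewrite tk !ltr_int; lia.
Qed.

Lemma closed_integer_points (R : realType) (n : nat) :
  closed (@integer_points R n).
Proof.
have -> : @integer_points R n =
    \bigcap_(i in [set: 'I_n]) [set x | x i 0 \is a Num.int].
  by apply/seteqP; split=> [x H i _|x H i]; apply: H.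
apply: closed_bigI => i _.
apply: (@preimage_closed _ _ (fun x : 'cV[R]_n => x i 0) [set t | t \is a Num.int]).
  by move=> x _; exact: coord_continuous.
exact: closed_int.
Qed.

Lemma integer_pointsP (R : realType) (n : nat) (x : 'cV[R]_n) :
  integer_points x <-> exists z : 'cV[int]_n, x = map_mx intr z.
Proof.
split=> [H|[z -> i]]; last by rewrite mxE intr_int.
exists (\col_i Num.floor (x i 0)); apply/colP => i; rewrite !mxE.
by have := H i; rewrite intrEfloor => /eqP.
Qed.

Lemma dotp_map_intr (R : realType) (n : nat) (u v : 'cV[int]_n) :
  dotp (map_mx intr u) (map_mx intr v) = ((u^T *m v) 0 0)%:~R :> R.
Proof. by rewrite /dotp map_trmx -map_mxM mxE. Qed.

(** The half-space of the inequality is convex, so it contains the hull as soon as it contains the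
    integer points. *)
Lemma valid_ineq_integer_hull (R : realType) (n : nat) (pi : 'cV[R]_n) (pi0 : R)
    (X : set 'cV[R]_n) :
  (forall x, X x -> integer_points x -> pi0 <= dotp pi x) ->
  valid_ineq pi pi0 (integer_hull X).
Proof.
move=> H x; apply: (@smallest_sub _ _ _ [set x | pi0 <= dotp pi x]).
  move=> u v t; rewrite !inE => /= Hu Hv.
  rewrite /conv /= dotpDr !dotpZr /unstable.onem.
  have t0 : 0 <= t%:num by [].
  have t1 : t%:num <= 1 by [].
  nra.
by move=> z [Xz Zz]; exact: H.
Qed.

(** * Finitely many integral cuts by compactness *)

Section rational_cuts.
Variables (R : realType) (m n : nat) (K : set 'cV[R]_m) (A : 'M[R]_(m, n))
  (b : 'cV[R]_m).
Hypotheses (K0 : K 0) (coneK : is_cone K) (convexK : convex_set K)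
  (closedK : closed K) (pointedK : pointed K).

Let T := [set x : 'cV[R]_n | cone_ge K (A *m x) b].

(** A nonzero kernel vector of [A], with its sign chosen so that [pi] does not increase along it,
    would span a ray inside the bounded set. *)
Lemma left_inverse_of_bounded (pi : 'cV[R]_n) (pi0 : R) :
  [set x | T x /\ dotp pi x <= pi0] !=set0 ->
  bounded_set [set x | T x /\ dotp pi x <= pi0] ->
  exists C : 'M[R]_(n, m), C *m A = 1%:M.
Proof.
move=> [x0 [Tx0 px0]] [M [_ bB]].
have {}bB x : T x -> dotp pi x <= pi0 -> `|x| <= M + 1.
  by move=> Tx px; apply: (bB (M + 1)); rewrite ?ltrDl.
have kerA0 d : A *m d = 0 -> dotp pi d <= 0 -> d = 0.
  move=> Ad pd; apply/eqP; apply: contraT; rewrite -normr_gt0 => d0.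
  have M0 : 0 <= M + 1 by apply: le_trans (bB _ Tx0 px0).
  (* Far enough that [x0 + t *: d] has norm at least [M + 2]. *)
  pose t := (M + 2 + `|x0|) / `|d|.
  have t0 : 0 <= t by rewrite divr_ge0// addr_ge0//; lra.
  have : `|x0 + t *: d| <= M + 1.
    apply: bB; last by rewrite dotpDr dotpZr; nra.
    by rewrite /T /= /cone_ge mulmxDr -scalemxAr Ad scaler0 addr0.
  have := ler_normB (x0 + t *: d) x0.
  rewrite addrAC subrr add0r normrZ ger0_norm// /t divfK ?gt_eqF//; lra.
have kerA (d : 'cV[R]_n) : A *m d = 0 -> d = 0.
  move=> Ad; have [/kerA0|pd] := leP (dotp pi d) 0; first exact.
  apply/oppr_inj; rewrite oppr0; apply: kerA0; rewrite ?mulmxN ?Ad ?oppr0//.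
  by rewrite dotpNr; lra.
have : row_free A^T.
  apply: inj_row_free => v vA; apply: trmx_inj; rewrite trmx0; apply: kerA.
  by rewrite -(trmxK A) -trmx_mul vA trmx0.
move=> /row_freeP[C AC]; exists C^T.
by rewrite -[LHS]trmxK trmx_mul trmxK AC trmx1.
Qed.

Lemma finite_integral_cuts (pi : 'cV[int]_n) (pi0 : R)
    (piR := map_mx intr pi : 'cV[R]_n) :
  (forall z : 'cV[int]_n, T (map_mx intr z) -> pi0 <= dotp piR (map_mx intr z)) ->
  [set x | T x /\ dotp piR x <= pi0] !=set0 ->
  bounded_set [set x | T x /\ dotp piR x <= pi0] ->
  exists2 s : seq 'cV[R]_m,
    forall y, y \in s -> dual_cone K y /\
      exists g : 'cV[int]_n, A^T *m y = map_mx intr g &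
    forall z : 'cV[int]_n, dotp piR (map_mx intr z) < pi0 ->
      exists2 y, y \in s & dotp y (A *m map_mx intr z - b) < 0.
Proof.
move=> validT B0 bB.
have [L LA] := left_inverse_of_bounded B0 bB.
have [x0 [Tx0 px0]] := B0; have {bB}[M [_ bB]] := bB.
(* One more than the bound [M + 1], so that no point of the bounded set lies on the sphere of radius
   [N]. *)
pose N := M + 2.
have {}bB x : T x -> dotp piR x <= pi0 -> `|x| < N.
  move=> Tx px; apply: (@le_lt_trans _ _ (M + 1)); last by rewrite /N; lra.
  by apply: (bB (M + 1)); rewrite ?ltrDl.
(* The value of [piR] at an integer point is an integer, so being below [pi0] means being at most
   [q]; this form is a closed condition. *)
pose q := (Num.ceil pi0 - 1)%:~R : R.
pose C := [set x : 'cV[R]_n | `|x| <= N] `&`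
  (([set x | N <= `|x|] `&` [set x | dotp piR x <= pi0]) `|`
   (@integer_points R n `&` [set x | dotp piR x <= q])).
have closed_half c : closed [set x | dotp piR x <= c].
  apply: (@preimage_closed _ _ (dotp piR) [set t | t <= c]); last exact: closed_le.
  by move=> x _; exact: dotp_continuous.
have compC : compact C.
  apply: compact_closedI; first exact: closed_ball_cV_compact.
  apply: closedU; apply: closedI => //; last exact: closed_integer_points.
  apply: (@preimage_closed _ _ (fun x : 'cV[R]_n => `|x|) [set t | N <= t]).
    by move=> x _; exact: norm_continuous.
  exact: closed_ge.
have CT x : C x -> ~ T x.
  move=> [/= xN [[/= Nx px]|[/integer_pointsP[z ->] /= zq]]] Tx.
    by have := bB _ Tx px; rewrite ltNge Nx.
  have := validT z Tx; have /andP[+ _] := ceil_itv pi0; move: zq.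
  by rewrite /q /piR; lra.
have [||s sD sC] := @compact_seq_cover _ _ C
    [set y | dual_cone K y /\ exists g : 'cV[int]_n, A^T *m y = map_mx intr g]
    (fun y => [set x | dotp y (A *m x - b) < 0]) compC.
- move=> y _.
  rewrite (_ : mkset _ = dotp (A^T *m y) @^-1` [set t | t < dotp y b]); last first.
    by apply/seteqP; split=> x /=; rewrite dotpBr dotp_mulmxr subr_lt0.
  apply: open_comp; last exact: open_lt.
  by move=> x _; exact: dotp_continuous.
- move=> x /CT nTx.
  have [y [Dy yx gy]] :=
    integral_cone_separation K0 coneK convexK closedK pointedK LA nTx.
  by exists y.
exists s => // z pz; set x := map_mx intr z.
have [xN|xN] := leP `|x| N.
  apply: sC; split=> //; right; split; first by apply/integer_pointsP; exists z.
  by move: pz; rewrite /x /piR /= !dotp_map_intr ler_int -ceil_gt_int lerBrDr lezD1.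
(* An integer point beyond the sphere: the segment from [x0] crosses the sphere at a point of the
   half-space, hence in [C]. The cut found there is nonnegative at [x0] and negative at the
   crossing, so it is negative at [x]. *)
have cont : continuous (fun t : R => `|x0 + t *: (x - x0)|).
  move=> t; apply: (@continuous_comp _ _ _ (fun t : R => x0 + t *: (x - x0))
    (fun w : 'cV[R]_n => `|w|)); last exact: norm_continuous.
  apply: cvgD; first exact: cvg_cst.
  by apply: cvgZr_tmp; exact: cvg_id.
have [|t t01 tN] := @IVT R _ 0 1 N ler01 (continuous_subspaceT cont).
  rewrite scale0r addr0 scale1r [x0 + _]addrC subrK.
  by rewrite ge_min le_max (ltW (bB _ Tx0 px0)) (ltW xN) orbT.
move: t01; rewrite in_itv /= => /andP[t0 t1].
have wE : x0 + t *: (x - x0) = (1 - t) *: x0 + t *: x.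
  by rewrite scalerBr scalerBl scale1r addrA addrAC.
have [|y ys yw] := sC (x0 + t *: (x - x0)).
  split; first by rewrite /= tN.
  left; split; first by rewrite /= tN.
  by rewrite /= wE dotpDr !dotpZr; rewrite -/x in pz; nra.
exists y => //.
have := (sD _ ys).1 _ Tx0.
move: yw; rewrite /= wE !dotpBr mulmxDr -!scalemxAr dotpDr !dotpZr.
by nra.
Qed.

End rational_cuts.


(** * Selection of at most 2^n cuts *)

Theorem theorem1 (R : realType) (m n : nat) (K : set 'cV[R]_m)
    (A : 'M[R]_(m, n)) (b : 'cV[R]_m) (pi : 'cV[int]_n) (pi0 : R)
    (T := [set x : 'cV[R]_n | cone_ge K (A *m x) b])
    (piR := map_mx intr pi : 'cV[R]_n)
    (B := [set x : 'cV[R]_n | T x /\ dotp piR x <= pi0]) :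
  regular_cone K ->
  interior T !=set0 ->
  pi != 0 ->
  valid_ineq piR pi0 (integer_hull T) ->
  B !=set0 ->
  bounded_set B ->
  exists (p : nat) (y : 'I_p -> 'cV[R]_m),
    [/\ (p <= 2 ^ n)%N,
        forall i, dual_cone K (y i),
        forall i, rational_mx ((y i)^T *m A)
      & valid_ineq piR pi0
          (integer_hull
            [set x : 'cV[R]_n |
               forall i, ((y i)^T *m b) 0 0 <= ((y i)^T *m A *m x) 0 0])].
Proof.
move=> [coneK pointedK closedK convexK _] _ _ validT B0 bB.
have K0 : K 0.
  have : [set 0] (0 : 'cV[R]_m) by [].
  by rewrite -pointedK => -[].
have validZ (z : 'cV[int]_n) : T (map_mx intr z) -> pi0 <= dotp piR (map_mx intr z).
  move=> Tz; apply: validT; apply: sub_gen_smallest; split=> //.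
  by apply/integer_pointsP; exists z.
have [s sD sP] := finite_integral_cuts K0 coneK convexK closedK pointedK validZ B0 bB.
pose y0 (i : 'I_(size s)) := nth 0 s i.
have y0s i : y0 i \in s by exact: mem_nth.
have /choice[g gP] : forall i, exists g : 'cV[int]_n, A^T *m y0 i = map_mx intr g.
  by move=> i; case: (sD _ (y0s i)).
have y0A i (z : 'cV[int]_n) :
    dotp (y0 i) (A *m map_mx intr z) = (((g i)^T *m z) 0 0)%:~R.
  by rewrite dotp_mulmxr gP dotp_map_intr.
(* Rounding the right-hand side up loses nothing at integer points, and it supplies the integer data
   that [doignon] works with. *)
have violated i (z : 'cV[int]_n) : (((g i)^T *m z) 0 0 < Num.ceil (dotp (y0 i) b))
    = (dotp (y0 i) (A *m map_mx intr z - b) < 0).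
  by rewrite ceil_gt_int dotpBr y0A subr_lt0.
have [|i x y z xyz|z /sP[y ys yz]|J Jn JP] := @doignon n 'I_(size s)
    [set z | dotp piR (map_mx intr z) < pi0]
    (fun i z => ((g i)^T *m z) 0 0) (fun i => Num.ceil (dotp (y0 i) b)).
- move=> x y z /= px py xyz.
  suff : dotp piR (map_mx intr x) + dotp piR (map_mx intr y)
      = dotp piR (map_mx intr z) * 2 by lra.
  by rewrite -dotpDr -map_mxD xyz raddfMn /= -scaler_nat dotpZr mulrC.
- by have := congr1 (fun w => ((g i)^T *m w) 0 0) xyz; rewrite !mulr2n !mulmxDr !mxE.
- have ylt : (index y s < size s)%N by rewrite index_mem.
  by exists (Ordinal ylt); rewrite violated /y0 /= nth_index.
exists #|J|, (fun k => y0 (enum_val k)); split => //.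
- by move=> k; case: (sD _ (y0s (enum_val k))).
- move=> k i j; rewrite -[A]trmxK -trmx_mul gP !mxE.
  by apply/rationalP; exists (g (enum_val k) j i), 1%N; rewrite divr1.
(* An integer point of the polyhedron below [pi0] would violate one of the selected cuts. *)
- apply: valid_ineq_integer_hull => x Qx /integer_pointsP[z xz].
  rewrite leNgt; apply/negP; rewrite xz => /JP[i iJ].
  rewrite violated dotpBr subr_lt0.
  have := Qx (enum_rank_in iJ i).
  by rewrite enum_rankK_in // -mulmxA xz leNgt => /negP.
Qed.
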